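(* For each non-negative integer $n$, \[ 3^n\sum_{k=0}^n (-1)^{k} \binom {n+k}{k} F_{2(n+1+2k)} = 1 - \sum_{k=0}^{n-1} (-3)^{k} \binom {2k+1}{k} \big(3 F_{6k+8} + F_{6k+10}\big), \] \[ 3^n\sum_{k=0}^n (-1)^{k}\binom {n+k}{k} L_{2(n+1+2k)} = 3 - \sum_{k=0}^{n-1} (-3)^{k}\binom {2k+1}{k} \big(3 L_{6k+8} + L_{6k+10}\big). \]
   Context: $F_j$ and $L_j$ denote the Fibonacci and Lucas numbers: $F_0=0,F_1=1$, $L_0=2,L_1=1$, both satisfying $X_j=X_{j-1}+X_{j-2}$. *)

(* Defs.v *)
From mathcomp Require Import all_boot all_order all_algebra.

Set Implicit Arguments.
Unset Strict Implicit.
Unset Printing Implicit Defensive.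

Fixpoint fib (n : nat) : nat :=
  match n with
  | 0 => 0
  | 1 => 1
  | (m.+1 as p).+1 => fib p + fib m
  end.

Fixpoint lucas (n : nat) : nat :=
  match n with
  | 0 => 2
  | 1 => 1
  | (m.+1 as p).+1 => lucas p + lucas m
  end.

(* Main.v *)
(* Put S_n(x) = sum_(k <= n) C(n+k,k) x^k.  Pascal's rule gives
   (1 - x) S_(n+1)(x) = S_n(x) + C(2n+1,n) x^(n+1) (1 - 2x).  For a root a of
   a^2 = a + 1 and x = - a^4, we have 1 - x = 3 a^2, so that
   3 a^(2n+4) S_(n+1)(x) = a^(2n+2) S_n(x)
                           - (-1)^n C(2n+1,n) (a^(6n+6) + 2 a^(6n+10)).
   Multiplying by 3^n and telescoping gives the identity for the sequence of
   powers of a, and the argument is linear in that sequence, so it applies to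
   any sequence with the Fibonacci recurrence. *)
Require Import Defs.
From mathcomp Require Import all_boot all_order all_algebra.
From mathcomp Require Import ring zify.
Import GRing.Theory.
Local Open Scope ring_scope.

(** The offset [s] is independent of [n] because the recurrence compares different offsets at the
    same [n]. *)
Definition altbin_sum (g : nat -> int) (n s : nat) : int :=
  \sum_(0 <= k < n.+1) (-1) ^+ k * 'C(n + k, k)%:Z * g (s + 2 * k)%N.

(** This is the recurrence for [(1 - x) S_(n+1)(x)], with [- x] read as the shift of [g] by two;
    hence no condition on [g]. *)
Lemma altbin_sum_pascal (g : nat -> int) (n s : nat) :
  altbin_sum g n.+1 s + altbin_sum g n.+1 s.+2 =
  altbin_sum g n s - (-1) ^+ n * 'C(2 * n + 1, n)%:Z
    * (g (s + 2 * n + 2)%N + 2 * g (s + 2 * n + 4)%N).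
Proof.
(* Pascal's rule splits each term past the first. Up to their top terms, the two sums are those at
   [n], [s] and at [n.+1], [s.+2]. *)
have shift : altbin_sum g n.+1 s = g s
    - \sum_(0 <= k < n.+1) (-1) ^+ k * 'C(n + k.+1, k.+1)%:Z * g (s + 2 * k.+1)%N
    - \sum_(0 <= k < n.+1) (-1) ^+ k * 'C(n.+1 + k, k)%:Z * g (s.+2 + 2 * k)%N.
  rewrite /altbin_sum big_nat_recl // bin0 muln0 addn0 expr0 !mul1r -addrA.
  congr (_ + _); rewrite -opprD -big_split -sumrN; apply: eq_bigr => k _ /=.
  rewrite addSn binS addSnnS PoszD exprS.
  have -> : (s.+2 + 2 * k = s + 2 * k.+1)%N by lia.
  ring.
have top : altbin_sum g n s = g s
    - \sum_(0 <= k < n.+1) (-1) ^+ k * 'C(n + k.+1, k.+1)%:Z * g (s + 2 * k.+1)%N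
    + (-1) ^+ n * 'C(2 * n + 1, n)%:Z * g (s + 2 * n + 2)%N.
  rewrite big_nat_recr //= /altbin_sum big_nat_recl //.
  rewrite bin0 muln0 addn0 expr0 !mul1r.
  have -> : 'C(n + n.+1, n.+1) = 'C(2 * n + 1, n).
    by rewrite -bin_sub ?leq_addl // addnK; congr 'C(_, _); lia.
  have -> : (s + 2 * n.+1 = s + 2 * n + 2)%N by lia.
  under eq_bigr => k _ do rewrite exprS mulN1r !mulNr.
  by rewrite sumrN; ring.
have last : altbin_sum g n.+1 s.+2 =
    \sum_(0 <= k < n.+1) (-1) ^+ k * 'C(n.+1 + k, k)%:Z * g (s.+2 + 2 * k)%N
    - (-1) ^+ n * (2 * 'C(2 * n + 1, n)%:Z) * g (s + 2 * n + 4)%N.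
  rewrite /altbin_sum big_nat_recr //=.
  (* The two Pascal summands of a central binomial coefficient agree by symmetry, whence the
     coefficient 2. *)
  have -> : 'C(n.+1 + n.+1, n.+1) = (2 * 'C(2 * n + 1, n))%N.
    rewrite addSn binS -(@bin_sub _ n.+1) ?leq_addl // addnK addnn -mul2n.
    by congr (2 * 'C(_, _))%N; lia.
  have -> : (s.+2 + 2 * n.+1 = s + 2 * n + 4)%N by lia.
  by rewrite PoszM exprS; ring.
by rewrite shift top last; ring.
Qed.

Lemma altbin_sum_fib_rec (u : nat -> int) (n : nat) :
    (forall m, u m.+2 = u m.+1 + u m) ->
  3 ^+ n * (\sum_(0 <= k < n.+1)
       (-1) ^+ k * 'C(n + k, k)%:Z * u (2 * (n + 1 + 2 * k))%N)
  = u 2%N - \sum_(0 <= k < n) (-3) ^+ k * 'C(2 * k + 1, k)%:Z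
         * (3 * u (6 * k + 8)%N + u (6 * k + 10)%N).
Proof.
move=> uS; pose g m := u (2 * m)%N.
(* This is [1 + a^4 = 3 a^2] for a root of [a^2 = a + 1]. *)
have gS m : g m + g m.+2 = 3 * g m.+1.
  rewrite /g; have -> : (2 * m.+2 = (2 * m).+4)%N by lia.
  have -> : (2 * m.+1 = (2 * m).+2)%N by lia.
  by rewrite !uS; ring.
rewrite -/(altbin_sum g n (n + 1)).
elim: n => [|n IHn].
  by rewrite /altbin_sum big_nat1 big_geq // bin0 !mul1r subr0.
(* The middle offset [n.+2] is the one the identity needs at [n.+1], and the 3 supplies the extra
   power. *)
have three : altbin_sum g n.+1 n.+1 + altbin_sum g n.+1 n.+3
    = 3 * altbin_sum g n.+1 n.+2.
  rewrite /altbin_sum -big_split mulr_sumr; apply: eq_bigr => k _ /=.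
  by rewrite -mulrDr !addSn gS; ring.
have step := altbin_sum_pascal g n n.+1.
(* One copy of the doubled term is absorbed by [gS]. *)
have g_split : g (n.+1 + 2 * n + 2)%N + 2 * g (n.+1 + 2 * n + 4)%N
    = 3 * u (6 * n + 8)%N + u (6 * n + 10)%N.
  have -> : u (6 * n + 8)%N = g (n.+1 + 2 * n + 2).+1 by congr u; lia.
  have -> : u (6 * n + 10)%N = g (n.+1 + 2 * n + 2).+2 by congr u; lia.
  have -> : (n.+1 + 2 * n + 4 = (n.+1 + 2 * n + 2).+2)%N by lia.
  by rewrite -gS; ring.
rewrite big_nat_recr //= opprD addrA -IHn !(addn1 n) (addn1 n.+1).
rewrite exprSr -mulrA -three step g_split.
by rewrite -[- 3]mulN1r exprMn; ring.
Qed.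

Theorem theorem18 (n : nat) :
  (3 ^+ n * (\sum_(0 <= k < n.+1)
       (-1) ^+ k * 'C(n + k, k)%:Z * (fib (2 * (n + 1 + 2 * k)))%:Z)
   = 1 - \sum_(0 <= k < n)
       (-3) ^+ k * 'C(2 * k + 1, k)%:Z
         * (3 * (fib (6 * k + 8))%:Z + (fib (6 * k + 10))%:Z) :> int)
  /\
  (3 ^+ n * (\sum_(0 <= k < n.+1)
       (-1) ^+ k * 'C(n + k, k)%:Z * (lucas (2 * (n + 1 + 2 * k)))%:Z)
   = 3 - \sum_(0 <= k < n)
       (-3) ^+ k * 'C(2 * k + 1, k)%:Z
         * (3 * (lucas (6 * k + 8))%:Z + (lucas (6 * k + 10))%:Z) :> int).
Proof.
split.
(* The constants 1 and 3 are the values of [fib 2] and [lucas 2], matched by computation. *)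
- by apply: (@altbin_sum_fib_rec (fun m => (fib m)%:Z)) => m; rewrite -PoszD.
- by apply: (@altbin_sum_fib_rec (fun m => (lucas m)%:Z)) => m; rewrite -PoszD.
Qed.
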